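(* For all integers $M,N\ge2$, $\lim_{p\to\infty}\delta_p(M,N)=0$.
   Context: For integers $M,N,p\ge1$, $\delta_p(M,N)=\frac{1}{(MN)^p}\#\{(a,b)\in\mathbb Z_M^p\times\mathbb Z_N^p:\{(a_y,b_y)\}_{y=1}^p=\{(a_y,b_{y+1})\}_{y=1}^p\text{ as multisets}\}$, with $b_{p+1}=b_1$. *)

(* Defs.v *)
From HB Require Import structures.
From mathcomp Require Import all_boot all_order all_algebra.
Set Implicit Arguments. Unset Strict Implicit. Unset Printing Implicit Defensive.
Import Order.TTheory GRing.Theory Num.Theory.

(* Z_M is represented by 'I_M (residues 0..M-1); for M >= 2 this is Z/MZ.
   A vector a in Z_M^p is a finite function 'I_p -> 'I_M; index y in
   {0..p-1} stands for y+1 in {1..p}; the cyclic successor is ordS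
   (value (y+1) mod p), so b_{p+1} = b_1. *)

Definition shift_multiset_eq (p M N : nat)
    (a : {ffun 'I_p -> 'I_M}) (b : {ffun 'I_p -> 'I_N}) : bool :=
  perm_eq [seq (a y, b y) | y <- enum 'I_p]
          [seq (a y, b (ordS y)) | y <- enum 'I_p].

Definition delta (p M N : nat) : rat :=
  (#|[set ab : {ffun 'I_p -> 'I_M} * {ffun 'I_p -> 'I_N}
        | shift_multiset_eq ab.1 ab.2]|%:R
   / ((M * N) ^ p)%:R)%R.

(* Main.v *)
Require Import Defs.
From HB Require Import structures.
From mathcomp Require Import all_boot all_order all_algebra.
From mathcomp Require Import zify.
Import Order.TTheory GRing.Theory Num.Theory.
Local Open Scope ring_scope.

(** Fix k and choose m disjoint blocks of 2k consecutive indices.  Let w_i (i < k) be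
    the block whose b-part is 0101...01 and whose a-part is 0 at the first i
    even offsets and 1 elsewhere.  Replacing w_i by w_j, i < j, increases
    #{y : (a_y, b_y) = (0,0)} but preserves #{y : (a_y, b_(y+1)) = (0,0)}, so
    at most one choice of i solves the multiset equation.  Replacing the first
    block of the form w_i by each of the w_j thus shows that the solutions
    containing such a block have density at most 1/k.  Writing w_0 over any of
    m blocks of a configuration without such a block (the overwritten content
    being remembered) shows that the latter have density at most
    (MN)^(2k) / m. *)

Local Open Scope nat_scope.

(** * Overwriting one of [m] disjoint blocks, and two counting bounds *)

Definition splice {I L Z : finType} {m : nat} (pos : 'I_m -> L -> I)
    (t : 'I_m) (x : {ffun I -> Z}) (w : {ffun L -> Z}) : {ffun I -> Z} :=
  [ffun y => if [pick o | pos t o == y] is Some o then w o else x y].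

Definition block {I L Z : finType} {m : nat} (pos : 'I_m -> L -> I)
    (t : 'I_m) (x : {ffun I -> Z}) : {ffun L -> Z} := [ffun o => x (pos t o)].

Definition first_block {I L Z : finType} {m : nat} (pos : 'I_m -> L -> I)
    (D : {set {ffun L -> Z}}) (x : {ffun I -> Z}) (t : 'I_m) : bool :=
  (block pos t x \in D) && [forall s : 'I_m, (s < t) ==> (block pos s x \notin D)].

Lemma splice_in {I L Z : finType} {m : nat} {pos : 'I_m -> L -> I}
    (pos_inj : forall s t o o', pos s o = pos t o' -> s = t /\ o = o')
    (t : 'I_m) (x : {ffun I -> Z}) (w : {ffun L -> Z}) (o : L) :
  splice pos t x w (pos t o) = w o.
Proof.
rewrite ffunE; case: pickP => [o' /eqP /pos_inj [_ ->] //|/(_ o)].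
by rewrite eqxx.
Qed.

Lemma block_splice {I L Z : finType} {m : nat} {pos : 'I_m -> L -> I}
    (pos_inj : forall s t o o', pos s o = pos t o' -> s = t /\ o = o')
    (s t : 'I_m) (x : {ffun I -> Z}) (w : {ffun L -> Z}) :
  block pos s (splice pos t x w) = if s == t then w else block pos s x.
Proof.
apply/ffunP=> o; rewrite ffunE; case: eqVneq => [->|st].
  exact: splice_in.
rewrite !ffunE; case: pickP => // o' /eqP /pos_inj [ts _].
by rewrite ts eqxx in st.
Qed.

Lemma splice_block {I L Z : finType} {m : nat} (pos : 'I_m -> L -> I)
    (t : 'I_m) (x : {ffun I -> Z}) (w : {ffun L -> Z}) :
  splice pos t (splice pos t x w) (block pos t x) = x.
Proof.
apply/ffunP=> y; rewrite !ffunE.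
by case: pickP => [o /eqP <-|_]; rewrite ?ffunE.
Qed.

Lemma first_block_inj {I L Z : finType} {m : nat} (pos : 'I_m -> L -> I)
    (D : {set {ffun L -> Z}}) (x : {ffun I -> Z}) (s t : 'I_m) :
  first_block pos D x s -> first_block pos D x t -> s = t.
Proof.
move=> /andP [sD /forallP sl] /andP [tD /forallP tl]; apply/val_inj/eqP => /=.
case: ltngtP => // lt.
  by have := tl s; rewrite lt sD.
by have := sl t; rewrite lt tD.
Qed.

Lemma first_block_ex {I L Z : finType} {m : nat} {pos : 'I_m -> L -> I}
    {D : {set {ffun L -> Z}}} {x : {ffun I -> Z}} {t : 'I_m} :
  block pos t x \in D -> exists t, first_block pos D x t.
Proof.
move=> tD.
case: (@arg_minnP _ t (fun t => block pos t x \in D) val tD) => s sD smin.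
exists s; apply/andP; split=> //; apply/forallP=> r; apply/implyP.
by apply: contraL => /smin; rewrite -leqNgt.
Qed.

Lemma first_block_splice {I L Z : finType} {m : nat} {pos : 'I_m -> L -> I}
    (pos_inj : forall s t o o', pos s o = pos t o' -> s = t /\ o = o')
    (D : {set {ffun L -> Z}}) (x : {ffun I -> Z}) (t : 'I_m) (w : {ffun L -> Z}) :
  w \in D -> (forall s : 'I_m, s < t -> block pos s x \notin D) ->
  first_block pos D (splice pos t x w) t.
Proof.
move=> wD lt; apply/andP; rewrite block_splice // eqxx; split=> //.
apply/forallP=> s; apply/implyP=> st; rewrite block_splice //.
case: eqVneq => [est|_]; last exact: lt.
by rewrite est ltnn in st.
Qed.

(** After [w] is written over block [t], that block is the only one in [D], hence the first, so [t]
    can be read off the result; the remembered content then restores [x]. *)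
Lemma card_without_block {I L Z : finType} {m : nat} {pos : 'I_m -> L -> I}
    (pos_inj : forall s t o o', pos s o = pos t o' -> s = t /\ o = o')
    {D : {set {ffun L -> Z}}} {w : {ffun L -> Z}} (wD : w \in D) :
  m * #|[set x : {ffun I -> Z} | [forall t, block pos t x \notin D]]|
    <= #|{ffun I -> Z}| * #|{ffun L -> Z}|.
Proof.
set B := [set x | _].
rewrite -{1}(card_ord m) -cardsT -cardsX -card_prod.
pose f (u : 'I_m * {ffun I -> Z}) := (splice pos u.1 u.2 w, block pos u.1 u.2).
rewrite -(@card_in_imset _ _ f) ?max_card // => -[t x] [t' x'].
rewrite !inE /= => /forallP xB /forallP xB' [exx' ebb'].
have tt' : t = t'.
  apply: (@first_block_inj _ _ _ _ pos D (splice pos t x w)).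
    exact: first_block_splice.
  by rewrite exx'; exact: first_block_splice.
rewrite -tt' in exx' ebb' *.
by rewrite -(splice_block pos t x w) exx' ebb' splice_block.
Qed.

(** Replacing the first block in [D] by [w j] is injective in the pair of [j] and the configuration:
    the block stays first, so its position and [j] are visible in the image. *)
Lemma card_with_block {I L Z : finType} {m k : nat} {pos : 'I_m -> L -> I}
    (pos_inj : forall s t o o', pos s o = pos t o' -> s = t /\ o = o')
    (w : 'I_k -> {ffun L -> Z}) (w_inj : injective w) (A : {set {ffun I -> Z}})
    (A_w : forall t x i j, splice pos t x (w i) \in A ->
       splice pos t x (w j) \in A -> i = j) :
  k * #|[set x in A | [exists t, block pos t x \in [set w i | i : 'I_k]]]|
    <= #|{ffun I -> Z}|.
Proof.
set D := [set w i | i : 'I_k]; set H := [set x in A | _].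
have wD i : w i \in D by exact: imset_f.
rewrite -{1}(card_ord k) -cardsT -cardsX.
pose f (u : 'I_k * {ffun I -> Z}) :=
  (* The default [u.2] is never reached on the domain, since members of [H] have a block in [D]. *)
  if [pick t | first_block pos D u.2 t] is Some t then splice pos t u.2 (w u.1)
  else u.2.
rewrite -(@card_in_imset _ _ f) ?max_card // => -[j x] [j' x'].
rewrite !inE /= => /andP [xA /existsP [s xs]] /andP [xA' /existsP [s' xs']].
rewrite /f /=.
case: pickP => [t ft|/= no]; last by have [r] := first_block_ex xs; rewrite no.
case: pickP => [t' ft'|/= no]; last by have [r] := first_block_ex xs'; rewrite no.
have lt r z v : first_block pos D z r -> v \in D ->
    first_block pos D (splice pos r z v) r.
  move=> /andP [_ /forallP zl] vD; apply: first_block_splice => // q qr.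
  by have := zl q; rewrite qr.
move=> E; have tt' : t = t'.
  apply: (@first_block_inj _ _ _ _ pos D (splice pos t x (w j))).
    exact: lt.
  by rewrite E; exact: lt.
rewrite -{}tt' in ft' E.
have /w_inj jj' : w j = w j'.
  by have := congr1 (block pos t) E; rewrite !block_splice // eqxx.
rewrite -{}jj' in E *.
case/andP: ft => /imsetP [i _ ei] _; case/andP: ft' => /imsetP [i' _ ei'] _.
(* Both preimages arise from the common image by writing some [w i] or [w i'] back into block [t];
   both lie in [A], so [A_w] identifies [i] and [i']. *)
have ex : x = splice pos t (splice pos t x (w j)) (w i) by rewrite -ei splice_block.
have ex' : x' = splice pos t (splice pos t x (w j)) (w i').
  by rewrite E -ei' splice_block.
have ii' : i = i' by apply: (A_w t (splice pos t x (w j))); rewrite -?ex -?ex'.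
by rewrite ex ex' ii'.
Qed.

(** * Consecutive blocks and staircase patterns *)

Definition block_pos {p m L : nat} (h : m * L <= p) (t : 'I_m) (o : 'I_L) : 'I_p.
Proof.
refine (@Ordinal p (t * L + o) _); apply: leq_trans h.
apply: (@leq_trans (t.+1 * L)); last by rewrite leq_mul2r ltn_ord orbT.
by rewrite mulSn addnC ltn_add2r.
Defined.

Lemma block_pos_inj {p m L : nat} (h : m * L <= p) (s t : 'I_m) (o o' : 'I_L) :
  block_pos h s o = block_pos h t o' -> s = t /\ o = o'.
Proof.
move=> /(congr1 val) /= E.
have L0 : 0 < L by case: L o {h o' E} => // -[].
have := congr1 (divn^~ L) E; have := congr1 (modn^~ L) E.
rewrite !modnMDl !modn_small // !divnMDl // !divn_small // !addn0.
by split; exact: val_inj.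
Qed.

(** The block w_i, with [a0], [b0] in the role of 0 and [a1], [b1] in that of 1. Each [a0] sits at
    an even offset, so the b-entry following it is [b1]. *)
Definition staircase {M N : nat} (a0 a1 : 'I_M) (b0 b1 : 'I_N) {k : nat}
    (i : 'I_k) : {ffun 'I_(k.*2) -> 'I_M * 'I_N} :=
  [ffun o : 'I_(k.*2) => (if ~~ odd o && (o./2 < i) then a0 else a1,
                          if odd o then b1 else b0)].

(** Multiplicities of [(u, v)] are written as sums over [y] so that two configurations can be
    compared index by index. *)
Lemma shift_multiset_eq_sum {p M N : nat} {a : {ffun 'I_p -> 'I_M}}
    {b : {ffun 'I_p -> 'I_N}} (u : 'I_M) (v : 'I_N) (ab : shift_multiset_eq a b) :
  \sum_y ((a y == u) && (b y == v)) = \sum_y ((a y == u) && (b (ordS y) == v)).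
Proof.
have cE (f : 'I_p -> 'I_M * 'I_N) :
    count (pred1 (u, v)) [seq f y | y <- enum 'I_p] = \sum_y (f y == (u, v)).
  rewrite -sum1_count big_map big_enum_cond big_mkcond; apply: eq_bigr => y _.
  by rewrite inE /=; case: eqP.
by move/permP: ab => /(_ (pred1 (u, v))); rewrite !cE.
Qed.

Lemma even_offset_subproof {k : nat} (r : 'I_k) : r.*2 < k.*2.
Proof. by rewrite ltn_double. Qed.

Lemma staircase_inj {M N : nat} {a0 a1 : 'I_M} (b0 b1 : 'I_N) {k : nat} :
  a0 != a1 -> injective (@staircase M N a0 a1 b0 b1 k).
Proof.
move=> a01 i j; wlog ij : i j / i < j.
  move=> W E; case: (ltngtP i j) => [lt|lt|/val_inj //]; first exact: W.
  by symmetry; apply: W.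
(* At offset 2i the smaller staircase has [a1] and the larger one [a0]. *)
move=> /ffunP /(_ (Ordinal (even_offset_subproof i))).
rewrite !ffunE /= odd_double doubleK ltnn ij /= => -[/esym/eqP].
by rewrite (negbTE a01).
Qed.

(** Passing from [i] to a larger [j] turns some [a1] into [a0] at even offsets. There the b-entry is
    [b0], so the unshifted count of [(a0, b0)] grows; the next one is [b1], so the shifted count
    does not change. *)
Lemma staircase_unique {p M N m k : nat} {a0 a1 : 'I_M} {b0 b1 : 'I_N}
    (h : m * k.*2 <= p) (a01 : a0 != a1) (b01 : b0 != b1)
    (t : 'I_m) (x : {ffun 'I_p -> 'I_M * 'I_N}) (i j : 'I_k)
    (A := [set z : {ffun 'I_p -> 'I_M * 'I_N} |
             shift_multiset_eq [ffun y => (z y).1] [ffun y => (z y).2]]) :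
  splice (block_pos h) t x (staircase a0 a1 b0 b1 i) \in A ->
  splice (block_pos h) t x (staircase a0 a1 b0 b1 j) \in A -> i = j.
Proof.
wlog ij : i j / i < j.
  move=> W Ai Aj; case: (ltngtP i j) => [lt|lt|/val_inj //]; first exact: W.
  by symmetry; apply: W.
set xi := splice _ _ _ _; set xj := splice _ _ _ (staircase _ _ _ _ j).
have sumE z : z \in A -> \sum_y (((z y).1 == a0) && ((z y).2 == b0))
    = \sum_y (((z y).1 == a0) && ((z (ordS y)).2 == b0)).
  rewrite inE => /(shift_multiset_eq_sum a0 b0) E.
  apply: etrans; last (apply: etrans; first exact: E);
    by apply: eq_bigr => y _; rewrite !ffunE.
move=> /sumE Ei /sumE Ej.
have xbE y : (xi y).2 = (xj y).2.
  by rewrite !ffunE; case: pickP => // o _; rewrite !ffunE.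
have xaE y : (xi y).1 = a0 -> (xj y).1 = a0.
  rewrite !ffunE; case: pickP => // o _; rewrite !ffunE /=.
  case: ifP => [/andP [-> /= oi] _|_ e]; last by rewrite e eqxx in a01.
  by rewrite (ltn_trans oi).
have shE : \sum_y (((xi y).1 == a0) && ((xi (ordS y)).2 == b0))
    = \sum_y (((xj y).1 == a0) && ((xj (ordS y)).2 == b0)).
  apply: eq_bigr => y _; rewrite -xbE.
  have [-> //|] := eqVneq (xi y) (xj y).
  rewrite [xi y]ffunE [xj y]ffunE; case: pickP => [o /eqP <-|_]; last by rewrite eqxx.
  rewrite [staircase _ _ _ _ i o]ffunE [staircase _ _ _ _ j o]ffunE.
  case: (boolP (odd o)) => [|oo _]; first by rewrite eqxx.
  (* The block length is even, so the successor of an even offset stays in the block and no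
     wrap-around modulo [p] occurs. *)
  have o1 : o.+1 < k.*2 by move: (ltn_ord o) oo; lia.
  have -> : ordS (block_pos h t o) = block_pos h t (Ordinal o1).
    apply: val_inj; rewrite /= -addnS modn_small //.
    exact: (ltn_ord (block_pos h t (Ordinal o1))).
  rewrite /xi (splice_in (block_pos_inj h)) ffunE /= oo /=.
  by rewrite (eq_sym b1) (negbTE b01) !andbF.
move: Ei; rewrite shE -{}Ej => E; exfalso; move: E.
(* Offset 2i gives the strict gain; by [xaE] no other index loses. *)
pose y0 := block_pos h t (Ordinal (even_offset_subproof i)).
rewrite (bigD1 y0) //= [RHS](bigD1 y0) //=.
rewrite /xi /xj !(splice_in (block_pos_inj h)) !ffunE /= odd_double doubleK ltnn ij /=.
rewrite !eqxx (eq_sym a1) (negbTE a01) /= add0n => E.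
suff : \sum_(y | y != y0) (((xi y).1 == a0) && ((xi y).2 == b0)) <=
       \sum_(y | y != y0) (((xj y).1 == a0) && ((xj y).2 == b0)).
  by rewrite E add1n ltnn.
apply: leq_sum => y _; rewrite -xbE.
by case: eqP => [/xaE -> | //]; rewrite eqxx.
Qed.

(** With [(M * N) ^ k.*2 * k] blocks, the factor [(M * N) ^ k.*2] from the remembered content
    cancels; solutions with and without a staircase block then each contribute at most
    [(M * N) ^ p]. *)
Lemma card_shift_multiset_eq {p M N k : nat} (hM : 1 < M) (hN : 1 < N)
    (k0 : 0 < k) (hp : ((M * N) ^ k.*2 * k) * k.*2 <= p) :
  k * #|[set ab : {ffun 'I_p -> 'I_M} * {ffun 'I_p -> 'I_N}
           | shift_multiset_eq ab.1 ab.2]| <= 2 * (M * N) ^ p.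
Proof.
pose a0 := Ordinal (ltnW hM); pose a1 := Ordinal hM.
pose b0 := Ordinal (ltnW hN); pose b1 := Ordinal hN.
have [a01 b01] : a0 != a1 /\ b0 != b1 by [].
pose X := {ffun 'I_p -> 'I_M * 'I_N}.
pose A := [set z : X | shift_multiset_eq [ffun y => (z y).1] [ffun y => (z y).2]].
pose w := @staircase M N a0 a1 b0 b1 k.
pose D := [set w i | i : 'I_k].
(* Merging [a] and [b] into one function lets a single splice rewrite both. *)
pose g (ab : {ffun 'I_p -> 'I_M} * {ffun 'I_p -> 'I_N}) : X :=
  [ffun y => (ab.1 y, ab.2 y)].
have g_inj : injective g.
  move=> [a b] [a' b'] /ffunP E; congr pair; apply/ffunP => y;
    by have := E y; rewrite !ffunE => -[].
have cX : #|{: X}| = (M * N) ^ p by rewrite card_ffun card_prod !card_ord.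
rewrite -(card_imset _ g_inj).
have sub : g @: [set ab | shift_multiset_eq ab.1 ab.2] \subset
    [set x in A | [exists t, block (block_pos hp) t x \in D]]
    :|: [set x | [forall t, block (block_pos hp) t x \notin D]].
  apply/subsetP=> _ /imsetP [[a b] + ->]; rewrite !inE /= => E.
  rewrite -negb_exists orbC; case: existsP => //= _; rewrite andbT.
  rewrite -[X in shift_multiset_eq X](_ : a = _); last by apply/ffunP=> y; rewrite !ffunE.
  by rewrite -[X in shift_multiset_eq _ X](_ : b = _) //; apply/ffunP=> y; rewrite !ffunE.
have wD : w (Ordinal k0) \in D by exact: imset_f.
have H1 := card_with_block (block_pos_inj hp) w
  (staircase_inj b0 b1 a01) A
  (fun t x i j => staircase_unique hp a01 b01 t x i j).
have H2 := card_without_block (block_pos_inj hp) wD.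
have Q0 : 0 < (M * N) ^ k.*2 by rewrite expn_gt0 muln_gt0 (ltnW hM) (ltnW hN).
rewrite cX in H1; rewrite cX card_ffun card_prod !card_ord in H2.
rewrite -mulnA [X in _ <= X]mulnC leq_pmul2l // in H2.
rewrite mul2n -addnn; apply: leq_trans (leq_add H1 H2).
rewrite -mulnDr leq_mul2l; apply/orP; right.
exact: leq_trans (subset_leq_card sub) (leq_card_setU _ _).
Qed.

(* Passage to the limit *)
Local Close Scope nat_scope.

(* lim_{p -> oo} delta_p(M,N) = 0  (delta >= 0, so |delta| < eps iff delta < eps) *)
Theorem theorem8p4 (M N : nat) (hM : (2 <= M)%N) (hN : (2 <= N)%N) :
  forall eps : rat, 0 < eps ->
    exists P : nat, forall p : nat, (P <= p)%N -> `|delta p M N| < eps.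
Proof.
(* The density is at most 2/k, and this [k] makes 2/k smaller than [eps]. *)
move=> eps eps0; pose k := Num.bound (2 / eps).
have keps : 2 / eps < k%:R by apply: archi_boundP; rewrite divr_ge0 // ltW.
have k0 : (0 < k)%N.
  by rewrite -(ltr_nat rat) (le_lt_trans _ keps) // divr_ge0 // ltW.
exists ((M * N) ^ k.*2 * k * k.*2)%N => p hp.
have Q0 : (0 : rat) < ((M * N) ^ p)%:R.
  by rewrite ltr0n expn_gt0 muln_gt0 (ltnW hM) (ltnW hN).
rewrite ger0_norm /delta ?divr_ge0 ?ler0n // ltr_pdivrMr //.
have := card_shift_multiset_eq hM hN k0 hp.
rewrite -(ler_nat rat) !natrM => H.
rewrite -(ltr_pM2l (_ : 0 < k%:R)) ?ltr0n //; apply: le_lt_trans H _.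
by rewrite mulrA ltr_pM2r // -ltr_pdivrMr.
Qed.
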